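(* Let $I\subset\mathbb{R}$ be an interval, let $(\gamma,\boldsymbol{\nu}):I\to\mathbb{R}_1^2\times\Delta$ be a non-lightlike Legendre curve with $\gamma(u)=(x_1(u),x_2(u))$, $\boldsymbol{\nu}(u)=(a(u),b(u))$, let $\delta=a^2(u)-b^2(u)$, and let $\lambda\neq 0$ be a real constant. If $\delta=1$, then the 1-type helicoidal surface $$\boldsymbol{r}_1:I\times\mathbb{R}\to\mathbb{R}_1^3,\qquad \boldsymbol{r}_1(u,v)=(x_1(u)+\lambda v,\ x_2(u)\sin v,\ x_2(u)\cos v)$$ is a lightcone framed base surface.
   Context: All maps are of class $C^\infty$. $\mathbb{R}_1^3$ is $\mathbb{R}^3$ with the pseudo inner product $\langle \boldsymbol{x},\boldsymbol{y}\rangle=-x_1y_1+x_2y_2+x_3y_3$, and $\mathbb{R}_1^2$ is $\mathbb{R}^2$ with $\langle \boldsymbol{x},\boldsymbol{y}\rangle=-x_1y_1+x_2y_2$. The pseudo wedge product on $\mathbb{R}_1^3$ is $\boldsymbol{x}\wedge\boldsymbol{y}=\big(-(x_2y_3-x_3y_2),\ -(x_1y_3-x_3y_1),\ x_1y_2-x_2y_1\big)$. Put $\Delta=\{\boldsymbol{x}\in\mathbb{R}_1^2:\langle\boldsymbol{x},\boldsymbol{x}\rangle=1\}\cup\{\boldsymbol{x}\in\mathbb{R}_1^2:\langle\boldsymbol{x},\boldsymbol{x}\rangle=-1\}$. A smooth map $(\gamma,\boldsymbol{\nu}):I\to\mathbb{R}_1^2\times\Delta$ is a non-lightlike Legendre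 curve if $\langle\gamma'(u),\boldsymbol{\nu}(u)\rangle=0$ for all $u\in I$; the number $\delta=a^2(u)-b^2(u)\in\{1,-1\}$ is constant on $I$. Let $LC^*$ be the set of non-zero vectors $\boldsymbol{x}\in\mathbb{R}_1^3$ with $\langle\boldsymbol{x},\boldsymbol{x}\rangle=0$ and $\Delta_4=\{(\boldsymbol{v},\boldsymbol{w})\in LC^*\times LC^*:\langle\boldsymbol{v},\boldsymbol{w}\rangle=-2\}$. For a domain $U$ of the $(u,v)$-plane, a smooth map $\boldsymbol{x}:U\to\mathbb{R}_1^3$ is a lightcone framed base surface if there exist a smooth map $(\ell^+,\ell^-):U\to\Delta_4$ and smooth functions $\alpha_1,\alpha_2:U\to\mathbb{R}$ such that $\boldsymbol{x}_u\wedge\boldsymbol{x}_v=\alpha_1\ell^++\alpha_2\ell^-$ on $U$. *)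

(* Defs.v *)
From HB Require Import structures.
From mathcomp Require Import all_boot all_order all_algebra.
From mathcomp Require Import all_classical all_reals all_analysis.

Set Implicit Arguments.
Unset Strict Implicit.
Unset Printing Implicit Defensive.

Import Order.TTheory GRing.Theory Num.Theory.
Import numFieldNormedType.Exports.

Local Open Scope classical_set_scope.
Local Open Scope ring_scope.

(* Maps on a subset [A] are represented by total functions.  [smooth_on A f]
   says that [f] is C^oo on an open neighbourhood of [A], i.e. all its iterated
   directional derivatives are Frechet differentiable there ([V] is meant to be
   finite-dimensional).  For open [A] one may take [O := A]; for other [A], such
   as an interval with endpoints, [f] stands for a smooth extension, as usual. *)
Definition smooth_on (R : realType) (V W : normedModType R) (A : set V)
    (f : V -> W) : Prop :=
  exists O : set V, [/\ open O, A `<=` O &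
    forall (ws : seq V) (p : V), O p ->
      differentiable (foldr (fun w g => 'D_w g) f ws) p].

Definition vec2 (R : realType) (x y : R) : 'rV[R]_2 :=
  \row_j nth 0 [:: x; y] j.

Definition vec3 (R : realType) (x y z : R) : 'rV[R]_3 :=
  \row_j nth 0 [:: x; y; z] j.

(* The pseudo inner product of R^{n+1}_1; the timelike coordinate comes first. *)
Definition pinner (R : realType) (n : nat) (x y : 'rV[R]_n.+1) : R :=
  - (x 0 0 * y 0 0) + \sum_(i < n) x 0 (lift ord0 i) * y 0 (lift ord0 i).

Definition pwedge (R : realType) (x y : 'rV[R]_3) : 'rV[R]_3 :=
  vec3 (- (x 0 1 * y 0 2 - x 0 2 * y 0 1))
       (- (x 0 0 * y 0 2 - x 0 2 * y 0 0))
       (x 0 0 * y 0 1 - x 0 1 * y 0 0).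

Definition Delta (R : realType) : set 'rV[R]_2 :=
  [set x | pinner x x = 1] `|` [set x | pinner x x = -1].

Definition non_lightlike_legendre (R : realType) (I : set R)
    (gamma nu : R -> 'rV[R]_2) : Prop :=
  [/\ smooth_on I gamma,
      smooth_on I nu,
      (forall u, I u -> Delta (nu u)) &
      (forall u, I u -> pinner (derive1 gamma u) (nu u) = 0)].

Definition LCstar (R : realType) : set 'rV[R]_3 :=
  [set x | x != 0 /\ pinner x x = 0].

Definition Delta4 (R : realType) : set ('rV[R]_3 * 'rV[R]_3) :=
  [set vw | [/\ LCstar vw.1, LCstar vw.2 & pinner vw.1 vw.2 = - 2]].

Definition lightcone_framed_base_surface (R : realType) (U : set (R * R))
    (x : R * R -> 'rV[R]_3) : Prop :=
  smooth_on U x /\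
  exists (lp lm : R * R -> 'rV[R]_3) (alpha1 alpha2 : R * R -> R),
    [/\ smooth_on U lp /\ smooth_on U lm,
        (forall p, U p -> Delta4 (lp p, lm p)),
        smooth_on U alpha1 /\ smooth_on U alpha2 &
        forall p, U p ->
          pwedge ('D_(1, 0) x p) ('D_(0, 1) x p) =
            alpha1 p *: lp p + alpha2 p *: lm p].

Definition helicoidal1 (R : realType) (lambda : R) (x1 x2 : R -> R)
    (p : R * R) : 'rV[R]_3 :=
  vec3 (x1 p.1 + lambda * p.2) (x2 p.1 * sin p.2) (x2 p.1 * cos p.2).

(* Main.v *)
Require Import Defs.
From HB Require Import structures.
From mathcomp Require Import all_boot all_order all_algebra.
From mathcomp Require Import all_classical all_reals all_analysis.
From mathcomp Require Import ring lra.

(** Why the theorem holds.  Write [s = sin v], [c = cos v].  The Legendre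
    condition [- x1' a + x2' b = 0] together with [a^2 - b^2 = 1] says that the
    velocity is a multiple of [(b, a)]: with [beta = x2' a - x1' b] one has
    [(x1', x2') = beta (b, a)] ([legendre_direction]).  The factor [beta] comes
    out of the wedge product of the two partial derivatives
    ([helicoidal_normal]), which is [beta n] with
      [n = (x2 a, b x2 s + lambda a c, b x2 c - lambda a s)].
    The velocity may vanish and [n] may have any causal character, but the
    spatial part of [n] never vanishes: its squared Euclidean length is
    [Q = (b x2)^2 + (lambda a)^2] ([sum_sqr_rotation]), and [a] has no zero
    because [a^2 = 1 + b^2].  So [e = (spatial part of n) / sqrt Q] is a smooth
    Euclidean unit vector, [l+ = (1, e)] and [l- = (1, - e)] are lightlike with
    product [-2] ([Delta4_vec3]), and
      [beta n = beta (x2 a + sqrt Q) / 2 l+ + beta (x2 a - sqrt Q) / 2 l-].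

    What remains is smoothness, on a neighbourhood of the (possibly not open)
    domain; there [a] must be kept away from zero, the equations themselves being
    needed only on the domain.  Since [smooth_on] bounds no order, it is proved
    by induction on the number [n] of differentiations: [ndiff n] passes to
    sums, products and composites because the derivative of such an expression
    is again of that form, with factors that are [ndiff n.-1].  The same
    induction gives [sin], [cos] and all the powers [powR ^~ r], whose families
    are stable under derivation; square roots and their inverses are the powers
    of exponent [1/2] and [-1/2]. *)

Set Implicit Arguments.
Unset Strict Implicit.
Unset Printing Implicit Defensive.

Import Order.TTheory GRing.Theory Num.Theory.
Import numFieldNormedType.Exports.

Local Open Scope classical_set_scope.
Local Open Scope ring_scope.

(** * Repeated differentiability *)

(** Differentiability at a point is local: both functions have the same first
    order expansion. *)
Lemma near_eq_differentiable (R : realType) (V W : normedModType R)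
    (f g : V -> W) (p : V) :
  (\near p, f p = g p) -> differentiable f p -> differentiable g p.
Proof.
move=> fg df.
have dcont : continuous ('d f p) by exact: diff_continuous.
have fgp : f p = g p := nbhs_singleton fg.
have gE : g \o shift p = cst (g p) + 'd f p +o_ 0 id.
  apply/eqaddoP => e e0.
  have /eqaddoP/(_ e e0) fe := diff_locally df.
  have fg0 : \forall h \near 0, f (h + p) = g (h + p).
    by move: fg; rewrite (near_shift 0 p); apply: filterS => h /=; rewrite subr0.
  near=> h.
  have : `|(f \o shift p - (cst (f p) + 'd f p)) h| <= e * `|h| by near: h.
  have fgh : f (h + p) = g (h + p) by near: h.
  by rewrite !fctE /= fgh fgp.
have dE := diff_unique dcont gE.
by apply/diff_locallyP; rewrite dE.
Unshelve. all: by end_near. Qed.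

Fixpoint ndiff (R : realType) (V W : normedModType R) (n : nat) (O : set V)
    (f : V -> W) : Prop :=
  if n is m.+1 then
    (forall p, O p -> differentiable f p) /\ forall w, ndiff m O ('D_w f)
  else True.

Section ndiff_theory.
Context {R : realType}.
Implicit Types V W : normedModType R.

Lemma ndiffW V W n (O : set V) (f : V -> W) : ndiff n.+1 O f -> ndiff n O f.
Proof. by elim: n f => [|n IH] f // [df Df]; split=> // w; exact/IH/Df. Qed.

Lemma ndiff_subset V W n (O O' : set V) (f : V -> W) :
  O' `<=` O -> ndiff n O f -> ndiff n O' f.
Proof.
move=> sO; elim: n f => [|n IH] f // [df Df].
by split=> [p /sO /df //|w]; exact/IH/Df.
Qed.

Lemma ndiff_congr V W n (O : set V) (f g : V -> W) :
  open O -> (forall p, O p -> f p = g p) -> ndiff n O f -> ndiff n O g.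
Proof.
move=> oO; elim: n f g => [|n IH] f g // fg [df Df].
have nearO p : O p -> \near p, f p = g p.
  by move=> Op; apply: filterS fg _; exact: open_nbhs_nbhs.
split=> [p Op|w]; first by apply: near_eq_differentiable (df p Op); exact: nearO.
by apply: IH (Df w) => p Op; apply: near_eq_derive; exact: nearO.
Qed.

(** The two formulations peel the derivatives of a list of directions from
    opposite ends, hence the use of [rcons]. *)
Lemma smooth_onP V W (A : set V) (f : V -> W) :
  smooth_on A f <->
  exists O, [/\ open O, A `<=` O & forall n, ndiff n O f].
Proof.
split=> -[B [oB AB Hf]]; exists B; split=> //.
- move=> n; elim: n f Hf => [|n IH] f Hf //; split; first exact: (Hf [::]).
  by move=> w; apply: IH => ws p Bp; have := Hf (rcons ws w) p Bp;
     rewrite foldr_rcons.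
- move=> ws; elim/last_ind: ws f Hf => [|ws w IH] f Hf p Bp /=.
    by have [df _] := Hf 1%N; exact: df.
  rewrite foldr_rcons; apply: IH => // n.
  by have [_] := Hf n.+1; exact.
Qed.

Lemma ndiff_cst V W n (O : set V) (c : W) : ndiff n O (fun=> c).
Proof.
elim: n c => [|n IH] c //; split=> [p _|w]; first exact: differentiable_cst.
rewrite (_ : 'D_w _ = fun=> 0) //.
by apply/funext => p; rewrite derive_cst.
Qed.

Lemma ndiffD V W n (O : set V) (f g : V -> W) : open O ->
  ndiff n O f -> ndiff n O g -> ndiff n O (fun p => f p + g p).
Proof.
move=> oO; elim: n f g => [|n IH] f g // [df Df] [dg Dg]; split=> [p Op|w].
  by apply: differentiableD; [exact: df|exact: dg].
apply: ndiff_congr (IH _ _ (Df w) (Dg w)) => // p Op.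
by rewrite -deriveD //; apply: diff_derivable; [exact: df|exact: dg].
Qed.

Lemma ndiffM V n (O : set V) (f g : V -> R) : open O ->
  ndiff n O f -> ndiff n O g -> ndiff n O (fun p => f p * g p).
Proof.
move=> oO; elim: n f g => [|n IH] f g // nf ng.
have [df Df] := nf; have [dg Dg] := ng; split=> [p Op|w].
  by apply: differentiableM; [exact: df|exact: dg].
have nfg := ndiffD oO (IH _ _ (ndiffW nf) (Dg w)) (IH _ _ (ndiffW ng) (Df w)).
apply: ndiff_congr nfg => // p Op.
by rewrite deriveM //; apply: diff_derivable; [exact: df|exact: dg].
Qed.

Lemma derive_linear V W (L : V -> W) (p w : V) :
  linear L -> continuous L -> differentiable L p /\ 'D_w L p = L w.
Proof.
move=> linL cL.
pose LM := GRing.isLinear.Build _ _ _ _ _ linL.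
pose LL : {linear V -> W} := HB.pack L LM.
have dL : differentiable L p by exact: (@linear_differentiable _ _ _ LL).
by split=> //; rewrite deriveE // (@diff_lin _ _ _ LL).
Qed.

Lemma ndiff_linear V W n (O : set V) (L : V -> W) :
  linear L -> continuous L -> ndiff n O L.
Proof.
case: n => [|n] // linL cL; split=> [p _|w].
  by have [] := derive_linear p 0 linL cL.
rewrite (_ : 'D_w L = fun=> L w); first exact: ndiff_cst.
by apply/funext => p; have [] := derive_linear p w linL cL.
Qed.

Lemma ndiff_linear_comp V W (W' : normedModType R) n (O : set V) (L : W -> W')
    (f : V -> W) : open O -> linear L -> continuous L ->
  ndiff n O f -> ndiff n O (fun p => L (f p)).
Proof.
move=> oO linL cL; elim: n f => [|n IH] f // [df Df].
have dL q : differentiable L q by have [] := derive_linear q 0 linL cL.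
split=> [p Op|w]; first by apply: differentiable_comp; [exact: df|exact: dL].
apply: ndiff_congr (IH _ (Df w)) => // p Op; have dfp := df p Op.
rewrite [RHS]deriveE; last exact: differentiable_comp.
rewrite diff_comp //= -!deriveE //.
by have [_ ->] := derive_linear (f p) ('D_w f p) linL cL.
Qed.

Lemma ndiffN V W n (O : set V) (f : V -> W) : open O ->
  ndiff n O f -> ndiff n O (fun p => - f p).
Proof.
move=> oO nf; apply: (ndiff_linear_comp (L := -%R) oO _ _ nf).
- by move=> c x y; rewrite opprD scalerN.
- exact: opp_continuous.
Qed.

Lemma derive_comp V (phi : R -> R) (f : V -> R) (p w : V) :
  differentiable f p -> differentiable phi (f p) ->
  'D_w (phi \o f) p = 'D_1 phi (f p) * 'D_w f p.
Proof.
move=> df dphi.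
rewrite !deriveE //; last exact: differentiable_comp.
rewrite diff_comp //= -[X in 'd _ _ X = _]mulr1.
by rewrite [LHS]linearZ mulrC.
Qed.

Lemma ndiff_comp V n (O : set V) (A : set R) (phi : R -> R) (f : V -> R) :
  open O -> (forall p, O p -> A (f p)) ->
  ndiff n A phi -> ndiff n O f -> ndiff n O (fun p => phi (f p)).
Proof.
move=> oO OA; elim: n phi => [|n IH] phi // [dphi Dphi] nf.
have [df Df] := nf; split=> [p Op|w].
  by apply: differentiable_comp; [exact: df|exact/dphi/OA].
apply: ndiff_congr (ndiffM oO (IH _ (Dphi 1) (ndiffW nf)) (Df w)) => // p Op.
by rewrite -derive_comp //; [exact: df|exact/dphi/OA].
Qed.

(** On the line one derivative controls the derivatives in all directions. *)
Lemma ndiffS_derive n (A : set R) (phi dphi : R -> R) : open A ->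
  (forall t, A t -> is_derive t 1 phi (dphi t)) ->
  ndiff n A dphi -> ndiff n.+1 A phi.
Proof.
move=> oA der nd.
have dphiP t : A t -> differentiable phi t.
  by move=> /der ?; apply/derivable1_diffP.
split=> // w; apply: ndiff_congr (ndiffM oA (ndiff_cst n A w) nd) => // t At.
rewrite deriveE; last exact: dphiP.
rewrite -[X in 'd _ _ X]mulr1 [RHS]linearZ -deriveE; last exact: dphiP.
by have -> := @derive_val _ _ _ _ _ _ _ (der t At).
Qed.

Lemma ndiff_sin_cos n : ndiff n [set: R] sin /\ ndiff n [set: R] cos.
Proof.
elim: n => [|n [nsin ncos]] //.
split; first exact: ndiffS_derive openT _ ncos.
apply: (ndiffS_derive (dphi := fun t => - sin t) openT) (ndiffN openT nsin).
Qed.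

Lemma ndiff_powR n (r : R) : ndiff n [set t : R | 0 < t] (@powR R ^~ r).
Proof.
elim: n r => [|n IH] r //.
have o0 : open [set t : R | 0 < t] by exact: open_gt.
apply: (ndiffS_derive o0 (fun t t0 => is_derive1_powR r t0)).
exact: ndiffM o0 (ndiff_cst _ _ r) (IH _).
Qed.

End ndiff_theory.

(** * Plane and space vectors given by their coordinates *)

Section coordinates.
Context {R : realType}.
Implicit Types V : normedModType R.

Lemma ndiff_vec2 V n (O : set V) (f g : V -> R) : open O ->
  ndiff n O (fun p => vec2 (f p) (g p)) -> ndiff n O f /\ ndiff n O g.
Proof.
move=> oO nfg.
have entry (j : 'I_2) : ndiff n O (fun p => vec2 (f p) (g p) 0 j).
  apply: (ndiff_linear_comp (L := fun N : 'rV[R]_2 => N 0 j) oO _ _ nfg).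
  - by move=> c x y; rewrite !mxE.
  - exact: coord_continuous.
by split; [move: (entry 0)|move: (entry 1)]; apply: ndiff_congr => // p _;
  rewrite mxE.
Qed.

Lemma ndiff_vec3 V n (O : set V) (f g h : V -> R) : open O ->
  ndiff n O f -> ndiff n O g -> ndiff n O h ->
  ndiff n O (fun p => vec3 (f p) (g p) (h p)).
Proof.
move=> oO nf ng nh.
have nscale (k : V -> R) (e : 'rV[R]_3) :
    ndiff n O k -> ndiff n O (fun p => k p *: e).
  move=> nk; apply: (ndiff_linear_comp (L := fun c : R => c *: e) oO _ _ nk).
  - by move=> c x y; rewrite scalerDl scalerA.
  - exact: scalel_continuous.
apply: ndiff_congr (ndiffD oO (ndiffD oO (nscale _ (vec3 1 0 0) nf)
  (nscale _ (vec3 0 1 0) ng)) (nscale _ (vec3 0 0 1) nh)) => // p _.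
apply/rowP => -[[|[|[|//]]] ?]; rewrite !mxE /=.
all: by rewrite !mulr0 !mulr1 ?add0r ?addr0.
Qed.

Lemma derive1_vec2 (f g : R -> R) (u : R) :
  differentiable (fun t => vec2 (f t) (g t)) u ->
  derive1 (fun t => vec2 (f t) (g t)) u = vec2 ('D_1 f u) ('D_1 g u).
Proof.
move=> df.
have entry (j : 'I_2) : (fun t => vec2 (f t) (g t) 0 j) = nth 0 [:: f; g] j.
  by apply/funext => t; rewrite mxE; case: j => -[|[|//]].
rewrite derive1E derive_mx; last exact: diff_derivable.
apply/rowP => j; rewrite mxE entry mxE.
by case: j => -[|[|//]].
Qed.

Lemma derive_vec3 V (f g h : V -> R) (p w : V) :
  differentiable f p -> differentiable g p -> differentiable h p ->
  'D_w (fun q => vec3 (f q) (g q) (h q)) p =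
  vec3 ('D_w f p) ('D_w g p) ('D_w h p).
Proof.
move=> df dg dh.
have entry (j : 'I_3) : (fun q => vec3 (f q) (g q) (h q) 0 j) =
    nth 0 [:: f; g; h] j.
  by apply/funext => q; rewrite mxE; case: j => -[|[|[|//]]].
rewrite derive_mx; last first.
  apply/derivable_mxP => i j; rewrite ord1 entry; apply: diff_derivable.
  by case: j => -[|[|[|//]]].
apply/rowP => j; rewrite mxE entry mxE.
by case: j => -[|[|[|//]]].
Qed.

Lemma pinner2E (x y : 'rV[R]_2) :
  pinner x y = - (x 0 0 * y 0 0) + x 0 1 * y 0 1.
Proof. by rewrite /pinner big_ord1; congr (_ + x 0 _ * y 0 _); exact/val_inj. Qed.

Lemma pinner_vec3 (x1 x2 x3 y1 y2 y3 : R) :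
  pinner (vec3 x1 x2 x3) (vec3 y1 y2 y3) = - (x1 * y1) + (x2 * y2 + x3 * y3).
Proof. by rewrite /pinner 2!big_ord_recl big_ord0 addr0 !mxE. Qed.

Lemma pwedge_vec3 (x1 x2 x3 y1 y2 y3 : R) :
  pwedge (vec3 x1 x2 x3) (vec3 y1 y2 y3) =
  vec3 (- (x2 * y3 - x3 * y2)) (- (x1 * y3 - x3 * y1)) (x1 * y2 - x2 * y1).
Proof. by rewrite /pwedge !mxE. Qed.

(** A Euclidean unit vector and its opposite, both lifted to height [1], span
    a lightlike frame. *)
Lemma Delta4_vec3 (e1 e2 : R) : e1 ^+ 2 + e2 ^+ 2 = 1 ->
  Delta4 (vec3 1 e1 e2, vec3 1 (- e1) (- e2)).
Proof.
move=> e_unit.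
have nz (y z : R) : vec3 1 y z != 0.
  by apply/eqP => /rowP/(_ 0); rewrite !mxE /= => /eqP; rewrite oner_eq0.
split=> /=; [split; first exact: nz|split; first exact: nz|].
all: rewrite pinner_vec3; lra.
Qed.

End coordinates.

(** * Functions of one of the two parameters *)

Section projections.
Context {R : realType}.
Implicit Types (p w : R * R) (O : set (R * R)).

Let fst_continuous : continuous (@fst R R).
Proof. by move=> ?; exact: cvg_fst. Qed.

Let snd_continuous : continuous (@snd R R).
Proof. by move=> ?; exact: cvg_snd. Qed.

Lemma derive_fst p w : differentiable (@fst R R) p /\ 'D_w (@fst R R) p = w.1.
Proof. exact: derive_linear. Qed.

Lemma derive_snd p w : differentiable (@snd R R) p /\ 'D_w (@snd R R) p = w.2.
Proof. exact: derive_linear. Qed.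

Lemma ndiff_fst n O : ndiff n O (@fst R R).
Proof. exact: ndiff_linear. Qed.

Lemma ndiff_snd n O : ndiff n O (@snd R R).
Proof. exact: ndiff_linear. Qed.

Lemma derive_comp_fst (f : R -> R) p w : differentiable f p.1 ->
  differentiable (f \o fst) p /\ 'D_w (f \o fst) p = 'D_1 f p.1 * w.1.
Proof.
move=> df; have [d1 D1] := derive_fst p w.
by split; [exact: differentiable_comp|rewrite derive_comp // D1].
Qed.

Lemma derive_comp_snd (f : R -> R) p w : differentiable f p.2 ->
  differentiable (f \o snd) p /\ 'D_w (f \o snd) p = 'D_1 f p.2 * w.2.
Proof.
move=> df; have [d2 D2] := derive_snd p w.
by split; [exact: differentiable_comp|rewrite derive_comp // D2].
Qed.

End projections.

(** * Geometry of the helicoidal surface *)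

Lemma derive_helicoidal1 (R : realType) (lambda : R) (x1 x2 : R -> R)
    (p w : R * R) : differentiable x1 p.1 -> differentiable x2 p.1 ->
  'D_w (helicoidal1 lambda x1 x2) p =
  vec3 ('D_1 x1 p.1 * w.1 + lambda * w.2)
       ('D_1 x2 p.1 * w.1 * sin p.2 + x2 p.1 * cos p.2 * w.2)
       ('D_1 x2 p.1 * w.1 * cos p.2 - x2 p.1 * sin p.2 * w.2).
Proof.
move=> d1 d2.
have [dx1 Dx1] := derive_comp_fst w d1; have [dx2 Dx2] := derive_comp_fst w d2.
have [dv Dv] := derive_snd p w.
have dsin : differentiable (@sin R) p.2 by exact/derivable1_diffP/derivable_sin.
have dcos : differentiable (@cos R) p.2 by exact/derivable1_diffP/derivable_cos.
have [dsv Dsv] := derive_comp_snd w dsin; have [dcv Dcv] := derive_comp_snd w dcos.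
have dl : differentiable (fun q : R * R => lambda * q.2) p.
  by apply: differentiableM; first exact: differentiable_cst.
rewrite /helicoidal1 derive_vec3; first congr vec3.
- rewrite (deriveD (diff_derivable dx1) (diff_derivable dl)) Dx1; congr (_ + _).
  rewrite deriveM; [|exact: derivable_cst|exact: diff_derivable].
  by rewrite derive_cst scaler0 addr0 Dv.
- rewrite (deriveM (diff_derivable dx2) (diff_derivable dsv)) Dx2 Dsv.
  by rewrite derive_val /GRing.scale /=; ring.
- rewrite (deriveM (diff_derivable dx2) (diff_derivable dcv)) Dx2 Dcv.
  by rewrite derive_val /GRing.scale /=; ring.
- exact: differentiableD dx1 dl.
- exact: differentiableM dx2 dsv.
- exact: differentiableM dx2 dcv.
Qed.

(** The vector [(b, a)] spans the pseudo-orthogonal complement of [(a, b)], and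
    [beta] is the coefficient of the velocity [(dx1, dx2)] along it. *)
Lemma legendre_direction (R : realType) (a b dx1 dx2 : R) :
  a ^+ 2 - b ^+ 2 = 1 -> - (dx1 * a) + dx2 * b = 0 ->
  let beta := dx2 * a - dx1 * b in
  dx1 = beta * b /\ dx2 = beta * a.
Proof.
move=> ab orth /=; split.
- transitivity (dx1 * (a ^+ 2 - b ^+ 2) + a * (- (dx1 * a) + dx2 * b)).
    by rewrite ab orth mulr1 mulr0 addr0.
  by ring.
- transitivity (dx2 * (a ^+ 2 - b ^+ 2) + b * (- (dx1 * a) + dx2 * b)).
    by rewrite ab orth mulr1 mulr0 addr0.
  by ring.
Qed.

Lemma helicoidal_normal (R : realType) (lambda b a x2 s c beta : R) :
  s ^+ 2 + c ^+ 2 = 1 ->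
  pwedge (vec3 (beta * b) (beta * a * s) (beta * a * c))
         (vec3 lambda (x2 * c) (- (x2 * s))) =
  beta *: vec3 (x2 * a) (b * x2 * s + lambda * a * c)
                        (b * x2 * c - lambda * a * s).
Proof.
move=> sc; rewrite pwedge_vec3; apply/rowP => -[[|[|[|//]]] i]; rewrite !mxE /=.
- by rewrite -[in RHS](mulr1 a) -sc; ring.
- by ring.
- by ring.
Qed.

Lemma sum_sqr_rotation (R : realType) (x y s c : R) : s ^+ 2 + c ^+ 2 = 1 ->
  (x * s + y * c) ^+ 2 + (x * c - y * s) ^+ 2 = x * x + y * y.
Proof.
by move=> sc; transitivity ((x * x + y * y) * (s ^+ 2 + c ^+ 2));
  [ring|rewrite sc mulr1].
Qed.

Lemma sin2Dcos2 (R : realType) (v : R) : sin v ^+ 2 + cos v ^+ 2 = 1.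
Proof. by rewrite addrC cos2Dsin2. Qed.

Lemma open_nonzero (R : realType) (O : set R) (f : R -> R) :
  open O -> (forall u, O u -> differentiable f u) ->
  open (O `&` [set u | f u != 0]).
Proof.
move=> oO df; rewrite openE => u [Ou fu0]; apply: filterI.
  exact: open_nbhs_nbhs.
have cf : {for u, continuous f} by exact/differentiable_continuous/df.
exact: (cf _ (open_nbhs_nbhs (conj (@open_neq R 0) fu0))).
Qed.

Theorem proposition3p4 (R : realType) (I : set R) (x1 x2 a b : R -> R)
    (delta lambda : R)
    (hI : is_interval I)
    (hL : non_lightlike_legendre I (fun u => vec2 (x1 u) (x2 u))
                                   (fun u => vec2 (a u) (b u)))
    (hdelta : forall u, I u -> delta = a u ^+ 2 - b u ^+ 2)
    (hlambda : lambda != 0)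
    (hdelta1 : delta = 1) :
  lightcone_framed_base_surface (I `*` [set: R]) (helicoidal1 lambda x1 x2).
Proof.
have [/smooth_onP[A1 [oA1 IA1 sg]] /smooth_onP[A2 [oA2 IA2 sn]] _ orth] := hL.
(* A neighbourhood of [I] on which the data are smooth and [a] has no zero;
   the relation [a^2 - b^2 = 1] is available on [I] only. *)
pose A : set R := A1 `&` (A2 `&` [set u | a u != 0]).
have oA : open A.
  apply: openI => //; apply: open_nonzero => // u A2u.
  by have [[da _] _] := ndiff_vec2 oA2 (sn 1%N); exact: da.
have ab1 u : I u -> a u ^+ 2 - b u ^+ 2 = 1.
  by move=> Iu; rewrite -hdelta1 (hdelta u Iu).
have IA u : I u -> A u.
  move=> Iu; split; first exact: IA1.
  split; first exact: IA2.
  apply/eqP => au0; have := ab1 u Iu; have := sqr_ge0 (b u).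
  by rewrite au0; lra.
have nx n : ndiff n A x1 /\ ndiff n A x2.
  by apply: ndiff_vec2 => //; apply: ndiff_subset (sg n) => u [].
have nn n : ndiff n A a /\ ndiff n A b.
  by apply: ndiff_vec2 => //; apply: ndiff_subset (sn n) => u [_ []].
pose O : set (R * R) := @fst R R @^-1` A.
have oO : open O by apply: open_comp oA => p _; exact: cvg_fst.
have smoothO (W : normedModType R) (f : R * R -> W) :
    (forall n, ndiff n O f) -> smooth_on (I `*` [set: R]) f.
  move=> nf; apply/smooth_onP; exists O; split=> // -[u v] [/= Iu _].
  exact: IA.
have nu n (f : R -> R) : ndiff n A f -> ndiff n O (fun p => f p.1).
  by move=> nf; apply: (ndiff_comp oO _ nf (ndiff_fst n O)).
have nsin n : ndiff n O (fun p => sin p.2).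
  by apply: (ndiff_comp oO _ (ndiff_sin_cos n).1 (ndiff_snd n O)).
have ncos n : ndiff n O (fun p => cos p.2).
  by apply: (ndiff_comp oO _ (ndiff_sin_cos n).2 (ndiff_snd n O)).
pose beta (u : R) : R := 'D_1 x2 u * a u - ('D_1 x1 u * b u).
have nbeta n : ndiff n A beta.
  have [[_ Dx1] [_ Dx2]] := nx n.+1; have [na nb] := nn n.
  by apply: ndiffD (ndiffM oA (Dx2 1) na) (ndiffN oA (ndiffM oA (Dx1 1) nb)).
have gammaE u : I u -> 'D_1 x1 u = beta u * b u /\ 'D_1 x2 u = beta u * a u.
  move=> Iu; have ab := ab1 u Iu; have := orth u Iu.
  rewrite derive1_vec2; last by have [dg _] := sg 1%N; exact: dg (IA1 _ Iu).
  by rewrite pinner2E !mxE /= => /(legendre_direction ab).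
pose Q u := (b u * x2 u) * (b u * x2 u) + (lambda * a u) * (lambda * a u).
have nQ n : ndiff n A Q.
  have [na nb] := nn n; have [_ nx2] := nx n.
  have nl := ndiffM oA (ndiff_cst n A lambda) na; have nbx := ndiffM oA nb nx2.
  exact: ndiffD oA (ndiffM oA nbx nbx) (ndiffM oA nl nl).
have Q0 u : A u -> 0 < Q u.
  move=> [_ [_ au0]]; rewrite /Q -!expr2.
  by rewrite ltr_wpDl ?sqr_ge0 // lt0r sqr_ge0 sqrf_eq0 mulf_neq0.
have nQr n r : ndiff n O (fun p => Q p.1 `^ r).
  apply: (nu n (fun u => Q u `^ r)).
  exact: (ndiff_comp oA Q0 (ndiff_powR n r) (nQ n)).
pose e1 p := (b p.1 * x2 p.1 * sin p.2 + lambda * a p.1 * cos p.2)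
             * Q p.1 `^ (- 2^-1).
pose e2 p := (b p.1 * x2 p.1 * cos p.2 - (lambda * a p.1 * sin p.2))
             * Q p.1 `^ (- 2^-1).
have ne1 n : ndiff n O e1.
  have [/nu na /nu nb] := nn n; have [_ /nu nx2] := nx n.
  apply: ndiffM => //; apply: ndiffD => //; first by do 2?apply: ndiffM.
  apply: ndiffM => //; apply: ndiffM => //; exact: ndiff_cst.
have ne2 n : ndiff n O e2.
  have [/nu na /nu nb] := nn n; have [_ /nu nx2] := nx n.
  apply: ndiffM => //; apply: ndiffD => //; first by do 2?apply: ndiffM.
  apply: ndiffN => //; apply: ndiffM => //; apply: ndiffM => //; exact: ndiff_cst.
(* The coefficients of [l+] and [l-] for [eps = 1] and [eps = -1]. *)
pose alpha (eps : R) (p : R * R) : R :=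
  beta p.1 * 2^-1 * (x2 p.1 * a p.1 + eps * Q p.1 `^ (2^-1)).
have nalpha eps n : ndiff n O (alpha eps).
  have [/nu na /nu nb] := nn n; have [_ /nu nx2] := nx n.
  apply: ndiffM => //; first by apply: ndiffM => //; [exact: nu|exact: ndiff_cst].
  apply: ndiffD => //; apply: ndiffM => //; exact: ndiff_cst.
split.
  apply: smoothO => n; have [/nu nx1 /nu nx2] := nx n.
  apply: ndiff_vec3 => //.
  - apply: ndiffD => //; apply: ndiffM => //; [exact: ndiff_cst|exact: ndiff_snd].
  - exact: ndiffM.
  - exact: ndiffM.
exists (fun p => vec3 1 (e1 p) (e2 p)), (fun p => vec3 1 (- e1 p) (- e2 p)),
  (alpha 1), (alpha (- 1)); split.
- split; apply: smoothO => n.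
    by apply: ndiff_vec3 => //; exact: ndiff_cst.
  by apply: ndiff_vec3 => //; [exact: ndiff_cst|exact: ndiffN|exact: ndiffN].
- move=> [u v] /= [/= /IA /Q0 Qu _]; apply: Delta4_vec3.
  have <- : Q u * (Q u `^ (- 2^-1)) ^+ 2 = 1.
    rewrite powRN powR12_sqrt ?ltW // exprVn sqr_sqrtr ?ltW //.
    by rewrite divff // gt_eqF.
  by rewrite /e1 /e2 /= !exprMn -mulrDl sum_sqr_rotation // sin2Dcos2.
- by split; exact: smoothO.
- move=> [u v] [/= Iu _].
  have Au := IA u Iu; have Qu := Q0 u Au; have [[d1 _] [d2 _]] := nx 1%N.
  have [x1E x2E] := gammaE u Iu.
  rewrite !derive_helicoidal1 /=; try solve [exact: d1|exact: d2].
  rewrite x1E x2E !(mulr0, mul0r, mulr1, addr0, add0r, subr0, sub0r).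
  rewrite (helicoidal_normal _ _ _ _ _ (sin2Dcos2 v)).
  have qr : Q u `^ (2^-1) * Q u `^ (- 2^-1) = 1.
    rewrite -powRD ?subrr ?powRr0 //.
    by apply/implyP => _; rewrite gt_eqF.
  apply/rowP => -[[|[|[|//]]] i]; rewrite !mxE /=.
  + by rewrite /alpha /=; field.
  + by rewrite /alpha /e1 /= -[LHS]mulr1 -[X in _ * X = _]qr; field.
  + by rewrite /alpha /e2 /= -[LHS]mulr1 -[X in _ * X = _]qr; field.
Qed.
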